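(* The following two statements are equivalent. (Strong Uniform Boundedness) For every $D\ge1$, $N\ge1$ and $d\ge2$ there is a constant $C_3(D,N,d)$ such that for all number fields $K/\mathbb Q$ satisfying $[K:\mathbb Q]\le D$ and all degree $d$ endomorphisms $f\in\mathrm{End}_d^N(K)$ of $\mathbb P^N$ defined over $K$, $$\#\bigl(\mathrm{PrePer}(f)\cap\mathbb P^N(K)\bigr)\le C_3(D,N,d).$$ (Strong Moduli Boundedness) For every $D\ge1$, $N\ge1$ and $d\ge2$ there is a constant $C_4(D,N,d)$ such that for all number fields $K/\mathbb Q$ satisfying $[K:\mathbb Q]\le D$ and all unweighted preperiodic portraits $\mathcal P=(\mathcal V,\Phi)$ satisfying $\#\mathcal V\ge C_4(D,N,d)$, $$\mathcal M_d^N[\mathcal P](K)=\emptyset.$$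
   Context: $\mathrm{PrePer}(f)$ is the set of preperiodic points of $f$. An unweighted preperiodic portrait is a pair $\mathcal P=(\mathcal V,\Phi)$ with $\mathcal V$ a finite set and $\Phi:\mathcal V\to\mathcal V$ a map. $\mathrm{End}_d^N$ is the space of degree $d$ endomorphisms $f=[f_0,\dots,f_N]$ of $\mathbb P^N$ ($f_i$ homogeneous of degree $d$ without common zero). $\mathrm{End}_d^N[\mathcal P]$ is the closed subscheme of $\mathrm{End}_d^N\times((\mathbb P^N)^{\mathcal V}\smallsetminus\text{big diagonal})$ of pairs $(f,(P_v)_{v\in\mathcal V})$ (with the $P_v$ distinct) satisfying $f(P_v)=P_{\Phi(v)}$ for all $v\in\mathcal V$. $\mathrm{SL}_{N+1}$ acts by $\varphi\star(f,(P_v))=(\varphi^{-1}\circ f\circ\varphi,(\varphi^{-1}(P_v)))$ and $\mathcal M_d^N[\mathcal P]=\mathrm{End}_d^N[\mathcal P]/\!/\mathrm{SL}_{N+1}$ is the GIT geometric quotient, a scheme over $\mathbb Z$ whose points over an algebraically closed field are the orbits. *)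

(* Defs.v *)
From HB Require Import structures.
From mathcomp Require Import all_boot all_order all_algebra all_field.
From mathcomp Require Import mpoly.

Set Implicit Arguments.
Unset Strict Implicit.
Unset Printing Implicit Defensive.

Import GRing.Theory.
Local Open Scope ring_scope.

(* P^N(F): lines through the origin of F^(N+1). *)
Definition proj_space (N : nat) (F : fieldType) :=
  {U : {vspace 'cV[F]_N.+1} | \dim U == 1%N}.

Lemma proj_pt0_subproof (N : nat) (F : fieldType) :
  \dim <[(delta_mx 0 0 : 'cV[F]_N.+1)%R]> == 1%N.
Proof.
rewrite dim_vline; suff -> : (delta_mx 0 0 : 'cV[F]_N.+1)%R != 0 by [].
by apply/eqP=> /matrixP/(_ 0 0)/eqP; rewrite !mxE !eqxx oner_eq0.
Qed.

Definition proj_pt0 (N : nat) (F : fieldType) : proj_space N F :=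
  Sub <[(delta_mx 0 0)%R]>%VS (proj_pt0_subproof N F).

(* The point [x_0 : ... : x_N]; the value at x = 0 is junk and is never used
   below: maps are only applied under a "no common zero" hypothesis, and
   coordinate changes and field automorphisms preserve x <> 0. *)
Definition proj_pt (N : nat) (F : fieldType) (x : 'cV[F]_N.+1) :
  proj_space N F := insubd (proj_pt0 N F) <[x]>%VS.

Definition coords (N : nat) (F : fieldType) (P : proj_space N F) :
  'cV[F]_N.+1 := vpick (val P).

Lemma coords_neq0 (N : nat) (F : fieldType) (P : proj_space N F) :
  coords P != 0.
Proof. by rewrite vpick0 -dimv_eq0 (eqP (valP P)). Qed.

Lemma proj_ptP (N : nat) (F : fieldType) (x y : 'cV[F]_N.+1) :
  x != 0 -> y != 0 ->
  proj_pt x = proj_pt y <-> exists2 c : F, c != 0 & y = c *: x.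
Proof.
move=> x0 y0; have vE z : z != 0 -> val (proj_pt z) = <[z]>%VS.
  by move=> z0; rewrite insubdK // unfold_in dim_vline z0.
split=> [/(congr1 val)|[c c0 ->]].
  rewrite !vE // => exy; have /vlineP[c yE] : y \in <[x]>%VS.
    by rewrite exy memv_line.
  exists c => //; apply: contraNneq y0 => c0.
  by rewrite yE c0 scale0r.
have cx0 : c *: x != 0 by rewrite scaler_eq0 negb_or c0.
apply: val_inj; rewrite !vE //; apply/eqP; rewrite eqEdim !dim_vline x0 cx0.
rewrite andbT -memvE; apply/vlineP; exists c^-1.
by rewrite scalerA mulVf // scale1r.
Qed.

Lemma coordsK (N : nat) (F : fieldType) (P : proj_space N F) :
  proj_pt (coords P) = P.
Proof.
have P0 := coords_neq0 P; apply: val_inj.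
rewrite insubdK ?unfold_in ?dim_vline ?P0 //; apply/eqP.
by rewrite eqEdim dim_vline P0 (eqP (valP P)) -memvE memv_pick.
Qed.

Definition poly_tuple (N : nat) (F : fieldType) :=
  {ffun 'I_N.+1 -> {mpoly F[N.+1]}}.

Definition eval_tuple (N : nat) (F : fieldType) (f : poly_tuple N F)
  (x : 'cV[F]_N.+1) : 'cV[F]_N.+1 := \col_i (f i).@[fun j => x j 0].

Definition map_tuple (N : nat) (F F' : fieldType) (s : {rmorphism F -> F'})
  (f : poly_tuple N F) : poly_tuple N F' := [ffun i => map_mpoly s (f i)].

(* f represents a point of End_d^N(F); iota is the embedding of F into an
   algebraic closure L, in which common zeros have to be excluded. *)
Definition is_endo (N d : nat) (F L : fieldType) (iota : {rmorphism F -> L})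
  (f : poly_tuple N F) : Prop :=
  (forall i, f i \is d.-homog) /\
  (forall x : 'cV[L]_N.+1, x != 0 -> eval_tuple (map_tuple iota f) x != 0).

(* The coefficients of f are homogeneous coordinates on End_d^N: proportional
   tuples are the same endomorphism. *)
Definition same_endo (N : nat) (F : fieldType) (f g : poly_tuple N F) : Prop :=
  exists2 c : F, c != 0 & forall i, g i = c *: f i.

Definition endo_map (N : nat) (F : fieldType) (f : poly_tuple N F)
  (P : proj_space N F) : proj_space N F := proj_pt (eval_tuple f (coords P)).

Definition preperiodic (T : Type) (g : T -> T) (P : T) : Prop :=
  exists m n : nat, (m < n)%N /\ iter m g P = iter n g P.

Definition card_at_most (T : eqType) (S : T -> Prop) (C : nat) : Prop :=
  exists s : seq T, (size s <= C)%N /\ forall x, S x -> x \in s.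

Definition marked_endo (N : nat) (V : finType) (F : fieldType) :=
  (poly_tuple N F * {ffun V -> proj_space N F})%type.

(* The points of End_d^N[(V, Phi)] over an algebraically closed field. *)
Definition is_marked_endo (N d : nat) (V : finType) (Phi : V -> V)
  (L : closedFieldType) (m : marked_endo N V L) : Prop :=
  [/\ is_endo d (idfun : {rmorphism L -> L}) m.1,
      injective m.2
    & forall v, endo_map m.1 (m.2 v) = m.2 (Phi v)].

(* The coordinates of A x, as linear forms in x. *)
Definition linear_forms (N : nat) (F : fieldType) (A : 'M[F]_N.+1) :
  N.+1.-tuple {mpoly F[N.+1]} := [tuple \sum_j A i j *: 'X_j | i < N.+1].

Definition conj_tuple (N : nat) (F : fieldType) (A : 'M[F]_N.+1)
  (f : poly_tuple N F) : poly_tuple N F :=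
  [ffun i => \sum_j invmx A i j *: (f j \mPo linear_forms A)].

(* The action A * (f, (P_v)) = (A^-1 o f o A, (A^-1 P_v)). *)
Definition sl_act (N : nat) (V : finType) (F : fieldType) (A : 'M[F]_N.+1)
  (m : marked_endo N V F) : marked_endo N V F :=
  (conj_tuple A m.1, [ffun v => proj_pt (invmx A *m coords (m.2 v))]).

Definition sl_orbit (N : nat) (V : finType) (F : fieldType)
  (m m' : marked_endo N V F) : Prop :=
  exists A : 'M[F]_N.+1,
    [/\ \det A = 1, same_endo (sl_act A m).1 m'.1 & (sl_act A m).2 = m'.2].

Definition map_marked (N : nat) (V : finType) (F F' : fieldType)
  (s : {rmorphism F -> F'}) (m : marked_endo N V F) : marked_endo N V F' :=
  (map_tuple s m.1, [ffun v => proj_pt (map_mx s (coords (m.2 v)))]).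

(* The points of M_d^N[(V, Phi)] over an algebraically closed field L: the
   orbits of SL_(N+1)(L) on End_d^N[(V, Phi)](L), an orbit being the set of all
   representatives (f, (P_v)) of its elements. *)
Definition moduli_geom_point (N d : nat) (V : finType) (Phi : V -> V)
  (L : closedFieldType) (O : marked_endo N V L -> Prop) : Prop :=
  exists2 m : marked_endo N V L, is_marked_endo d Phi m &
    forall m', O m' <-> sl_orbit m m'.

(* The points of M_d^N[(V, Phi)] over a perfect field K with algebraic closure
   iota : K -> L.  As for every scheme over Z, these are the L-points invariant
   under Gal(L/K); the Galois group acts on orbits through representatives
   since the quotient map is defined over Z.  This is weaker than asking for a
   representative (f, (P_v)) with coordinates in K. *)
Definition moduli_point (N d : nat) (V : finType) (Phi : V -> V)
  (K : fieldType) (L : closedFieldType) (iota : {rmorphism K -> L})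
  (O : marked_endo N V L -> Prop) : Prop :=
  moduli_geom_point d Phi O /\
  forall s : {rmorphism L -> L}, bijective s ->
    (forall x, s (iota x) = iota x) -> forall m, O m -> O (map_marked s m).

(* Main.v *)
Require Import Defs.
From HB Require Import structures.
From mathcomp Require Import all_boot all_order all_algebra all_field.
From mathcomp Require Import mpoly.
From mathcomp Require Import ring.
From Stdlib Require Import Classical.

Set Implicit Arguments.
Unset Strict Implicit.
Unset Printing Implicit Defensive.

Import GRing.Theory Num.Theory.
Local Open Scope ring_scope.

(* Let (f, (P_v)) represent a K-point of the moduli space.  Every automorphism
   of algC over K moves (P_v) by a projective transformation.  Writing the P_v
   in terms of a basis of their span chosen among them, the automorphism changes
   the resulting coefficient matrix only by rescaling rows and columns; a
   suitable rescaling makes all entries Galois invariant, so that after a change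
   of coordinates all the P_v are K-rational.  The map f itself need not descend
   to K, but the condition f(P_v) = P_Phi(v) is now K-linear in the coefficients
   of f, and having no common zero is a Zariski open condition; hence some
   endomorphism g over K satisfies g(P_v) = P_Phi(v) for all v, and the bound on
   preperiodic points of g bounds the number of the P_v.  Conversely, the forward
   orbits of finitely many K-rational preperiodic points of f form a portrait
   defined over K. *)

(** * Elimination theory *)

(** In characteristic 0 the naturals below [size p] have distinct images, and these are more than
    [p] can have roots. *)
Lemma exists_nat_nonroot (R : idomainType) (p : {poly R}) :
  [pchar R] =i pred0 -> p != 0 -> exists m : nat, p.[m%:R] != 0.
Proof.
move=> R0 p0; pose s : seq R := [seq m%:R | m <- iota 0 (size p)].
have Us : uniq s.
  rewrite map_inj_uniq ?iota_uniq // => i j /eqP.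
  wlog ltij : i j / (i <= j)%N => [hw|].
    by case/orP: (leq_total i j) => h e; [|apply/esym];
      apply: hw; rewrite // eq_sym.
  rewrite eq_sym -subr_eq0 -natrB //; move/pcharf0P: R0 => ->.
  by rewrite subn_eq0 => leji; apply/anti_leq; rewrite ltij.
have [/(max_poly_roots p0)/(_ Us)|] := boolP (all (root p) s).
  by rewrite size_map size_iota ltnn.
by case/allPn=> _ /mapP[m _ ->] pm; exists m.
Qed.

(* [A[x_0, ..., x_(n-1)]], as iterated univariate polynomials so that resultants
   in the last variable are available. *)
Fixpoint tower (A : comNzRingType) (n : nat) : comNzRingType :=
  if n is n'.+1 then {poly tower A n'} else A.

Fixpoint tower_eval (A L : comNzRingType) (phi : {rmorphism A -> L})
    (a : nat -> L) (n : nat) : {rmorphism tower A n -> L} :=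
  match n return {rmorphism tower A n -> L} with
  | 0 => phi
  | n'.+1 => horner_eval (a n') \o map_poly (tower_eval phi a n')
  end.

Fixpoint tower_const (A : comNzRingType) (n : nat) : A -> tower A n :=
  match n return A -> tower A n with
  | 0 => id
  | n'.+1 => fun c => (tower_const n' c)%:P
  end.

Fixpoint tower_var (A : comNzRingType) (n k : nat) : tower A n :=
  match n return tower A n with
  | 0 => 0
  | n'.+1 => if k == n' then 'X else (tower_var A n' k)%:P
  end.

(* Elements of [A] have degree 0. *)
Fixpoint hom_part (A : comNzRingType) (n e : nat) : tower A n -> tower A n :=
  match n return tower A n -> tower A n with
  | 0 => fun c => if e == 0%N then c else 0
  | n'.+1 => fun p => \poly_(i < e.+1) @hom_part A n' (e - i) p`_i
  end.

Section Tower.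

Variables (A L : comNzRingType).
Implicit Types (phi : {rmorphism A -> L}) (a b : nat -> L).

Lemma tower_evalS phi a n (p : tower A n.+1) :
  tower_eval phi a n.+1 p = (map_poly (tower_eval phi a n) p).[a n].
Proof. by []. Qed.

Lemma tower_evalC phi a n (p : tower A n) :
  tower_eval phi a n.+1 p%:P = tower_eval phi a n p.
Proof. by rewrite tower_evalS map_polyC hornerC. Qed.

Lemma tower_eval_const phi a n (c : A) :
  tower_eval phi a n (tower_const n c) = phi c.
Proof. by elim: n => //= n IH; rewrite /horner_eval map_polyC hornerC. Qed.

Lemma tower_eval_var phi a n k : (k < n)%N ->
  tower_eval phi a n (tower_var A n k) = a k.
Proof.
elim: n => // n IH; rewrite ltnS leq_eqVlt tower_evalS /=.
have [->|_ /= ltkn] := eqVneq; first by rewrite map_polyX hornerX.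
by rewrite map_polyC hornerC; apply: IH.
Qed.

Lemma eq_tower_eval phi a b n : (forall k, (k < n)%N -> a k = b k) ->
  tower_eval phi a n =1 tower_eval phi b n.
Proof.
elim: n => // n IH eq_ab p; rewrite !tower_evalS eq_ab //.
by rewrite (eq_map_poly (IH _)) // => k ltkn; apply/eq_ab/ltnW.
Qed.

Lemma hom_part0 n e : @hom_part A n e 0 = 0.
Proof.
elim: n e => [|n IH] e /=; first by case: eqP.
by apply/polyP=> i; rewrite coef_poly coef0 IH if_same.
Qed.

Lemma hom_partC n e (p : tower A n) :
  @hom_part A n.+1 e p%:P = (hom_part e p)%:P.
Proof.
apply/polyP=> i; rewrite /= coef_poly !coefC.
by case: i => [|i] /=; rewrite ?subn0 // hom_part0 if_same.
Qed.

Lemma hom_part_deg0 n (p : tower A n) :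
  exists c, hom_part 0 p = tower_const n c.
Proof.
elim: n p => [|n IH] p /=; first by exists p.
have [c Dc] := IH p`_0; exists c; rewrite -Dc; apply/polyP=> i.
by rewrite coef_poly coefC; case: i.
Qed.

Lemma tower_eval_hom_part phi a x n e (p : tower A n) :
  tower_eval phi (fun k => x * a k) n (hom_part e p) =
  x ^+ e * tower_eval phi a n (hom_part e p).
Proof.
elim: n e p => [|n IH] e p /=.
  by case: e => [|e] /=; rewrite ?mul1r // rmorph0 mulr0.
rewrite /horner_eval !(@horner_coef_wide _ e.+1); last 2 first.
- exact: leq_trans (size_poly _ _) (size_poly _ _).
- exact: leq_trans (size_poly _ _) (size_poly _ _).
rewrite mulr_sumr; apply: eq_bigr => i _; rewrite !coef_map coef_poly ltn_ord.
rewrite /= IH exprMn_comm; last exact: mulrC.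
by rewrite mulrACA -exprD subnK ?mulrA // -ltnS.
Qed.

(** The induction needs a statement about all large [m']: the coefficient of ['X^i] is decomposed
    with the bound lowered by [i], and [m + size p] leaves at least [m] for each of them. *)
Lemma sum_hom_part n (p : tower A n) :
  exists m, forall m', (m <= m')%N -> p = \sum_(e < m') hom_part e p.
Proof.
elim: n p => [|n IH] p.
  by exists 1%N => -[//|m] _; rewrite big_ord_recl /= big1 ?addr0.
have [m Dm] : exists m, forall i m', (m <= m')%N ->
    p`_i = \sum_(e < m') hom_part e p`_i.
  elim/poly_ind: p => [|p c [m Dm]].
    by exists 0%N => i m' _; rewrite coef0 big1 // => e _; rewrite hom_part0.
  have [mc Dmc] := IH c; exists (maxn m mc) => i m'.
  rewrite geq_max => /andP[le_m le_mc]; rewrite coefD coefMX coefC.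
  by case: i => [|i] /=; rewrite ?add0r ?addr0; [apply: Dmc|apply: Dm].
exists (m + size p)%N => m' le_m'; apply/polyP=> i; rewrite coef_sum.
have [ltip|lepi] := ltnP i (size p); last first.
  rewrite nth_default // big1 // => e _ /=; rewrite coef_poly nth_default //.
  by rewrite hom_part0 if_same.
rewrite (Dm i (m' - i)%N); last first.
  by rewrite -(leq_add2r i) subnK ?(leq_trans _ le_m') ?leq_add2l 1?ltnW
    ?ltn_addl.
have leim' : (i <= m')%N by rewrite (leq_trans _ le_m') // ltnW // ltn_addl.
rewrite -(big_mkord xpredT (fun e => hom_part e p`_i)).
rewrite -(big_mkord xpredT (fun e => (@hom_part A n.+1 e p)`_i)).
rewrite [in RHS](@big_cat_nat _ _ _ i) //= [in RHS]big_nat_cond.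
rewrite [in RHS]big1 => [|e]; last first.
  by rewrite andbT => /andP[_ ltei]; rewrite coef_poly ltnS leqNgt ltei.
rewrite add0r -[X in _ = \sum_(X <= _ < _) _]add0n [in RHS]big_addn.
apply: eq_bigr => e _.
by rewrite coef_poly ltnS leq_addl addnK.
Qed.

End Tower.

(** The format of the Sylvester matrix depends on the sizes of both polynomials, which [f] preserves
    when the leading coefficients survive; then [f] acts entrywise. *)
Lemma rmorph_resultant (A R : nzRingType) (f : {rmorphism A -> R})
    (p q : {poly A}) :
  f (lead_coef p) != 0 -> f (lead_coef q) != 0 ->
  f (resultant p q) = resultant (map_poly f p) (map_poly f q).
Proof.
move=> fp0 fq0; rewrite /resultant -det_map_mx /Sylvester_mx.
rewrite !size_map_poly_id0 // map_col_mx; congr (\det (col_mx _ _)).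
  by apply: map_lin1_mx => v; rewrite map_poly_rV rmorphM /= map_rVpoly.
by apply: map_lin1_mx => v; rewrite map_poly_rV rmorphM /= map_rVpoly.
Qed.

Definition graded_ideal (A : comNzRingType) (n : nat) (I : tower A n -> Prop) :=
  [/\ exists p, I p,
      forall p q, I p -> I q -> I (p + q),
      forall p q, I q -> I (p * q)
    & forall e p, I p -> I (hom_part e p)].

Definition is_zero (A L : comNzRingType) (n : nat) (I : tower A n -> Prop)
    (phi : {rmorphism A -> L}) (a : nat -> L) :=
  forall p, I p -> tower_eval phi a n p = 0.

(** With [phi] seen as an [L]-point of Spec [A], this says that the projective zero set of [I] has
    no [L]-points over [phi]. *)
Definition no_proj_zero (A L : comNzRingType) (n : nat) (I : tower A n -> Prop)
    (phi : {rmorphism A -> L}) :=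
  forall a, is_zero I phi a -> forall k, (k < n)%N -> a k = 0.

Section Elimination.

Variables (A : comNzRingType) (L : closedFieldType).
Hypothesis L0 : [pchar L] =i pred0.

(** Induction on [s]: if [g] works on the tail and [g1] at the head, then [g + m * g1] works for
    some natural [m], since each point only excludes the roots of a nonzero polynomial in [m]. *)
Lemma ideal_avoids_zeros (R : comNzRingType) (T : eqType)
    (I : R -> Prop) (ev : T -> {rmorphism R -> L}) (s : seq T) :
    (exists p, I p) -> (forall p q, I p -> I q -> I (p + q)) ->
    (forall p q, I q -> I (p * q)) ->
    (forall t, t \in s -> exists2 g, I g & ev t g != 0) ->
  exists2 g, I g & forall t, t \in s -> ev t g != 0.
Proof.
move=> [p0 Ip0] ID IM; elim: s => [|t s IH] evs; first by exists p0.
have [u us|g Ig gs] := IH; first by apply: evs; rewrite inE us orbT.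
have [g1 Ig1 g1t] := evs t (mem_head t s).
pose P u := (ev u g)%:P + ev u g1 *: 'X.
have PE u (m : nat) : (P u).[m%:R] = ev u (g + m%:R * g1).
  by rewrite !hornerE rmorphD rmorphM rmorph_nat [_ * m%:R]mulrC.
have P0 u : u \in t :: s -> P u != 0.
  move=> us; apply/eqP=> Pu0.
  have g_u : ev u g = 0.
    by have := PE u 0%N; rewrite Pu0 horner0 mul0r addr0.
  have g1_u : ev u g1 = 0.
    by have := PE u 1%N; rewrite Pu0 horner0 mul1r rmorphD g_u add0r.
  move: us; rewrite inE => /predU1P[ut|/gs]; last by rewrite g_u eqxx.
  by rewrite -ut g1_u eqxx in g1t.
have [|m] := @exists_nat_nonroot _ (\prod_(u <- t :: s) P u) L0.
  by rewrite prodf_seq_neq0; apply/allP=> u us; apply: P0.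
rewrite horner_prod prodf_seq_neq0 => /allP mP.
exists (g + m%:R * g1) => [|u us]; first by apply: ID => //; apply: IM.
by rewrite -PE; apply: mP.
Qed.

(* [f] has a degree in the last variable that does not drop at [(phi, a)], so
   that its resultant with an element of [I] vanishing at none of the roots of
   [f(a, .)] would be an element of the elimination ideal not vanishing at
   [a]. *)
Lemma extend_zero n (I : tower A n.+1 -> Prop) (phi : {rmorphism A -> L})
    (a : nat -> L) (f : tower A n.+1) (c : A) :
    graded_ideal I -> I f -> lead_coef f = tower_const n c -> phi c != 0 ->
    is_zero (fun q : tower A n => I q%:P) phi a ->
  exists b, forall g, I g -> (map_poly (tower_eval phi a n) g).[b] = 0.
Proof.
move=> [I0 ID IM _] If lf c0 Ia; set ev := tower_eval phi a n in Ia *.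
have evf0 : ev (lead_coef f) != 0 by rewrite lf tower_eval_const.
apply: NNPP => no_b.
have [rs Drs] := closed_field_poly_normal (map_poly ev f).
have root_rs b : (map_poly ev f).[b] = 0 -> b \in rs.
  move=> /eqP; rewrite -[_ == 0]/(root _ b) Drs rootZ ?root_prod_XsubC //.
  by rewrite lead_coef_map_eq.
have [b _|g Ig g_rs] :=
    @ideal_avoids_zeros _ _ I (fun b => horner_eval b \o map_poly ev)
      rs I0 ID IM.
  apply: NNPP => no_g; apply: no_b; exists b => g Ig; apply: NNPP => gb0.
  by apply: no_g; exists g => //; apply/eqP.
have f0 : f != 0.
  by apply: contraNneq evf0 => ->; rewrite lead_coef0 rmorph0.
(* If [f] did not involve the last variable, it would lie in the elimination ideal and vanish at
   [a]. *)
have szf : (1 < size f)%N.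
  rewrite ltnNge; apply: contraNN evf0 => /size1_polyC Df; apply/eqP.
  by move: If; rewrite Df => /Ia; rewrite lead_coefC.
(* [h] agrees with [g] at the roots of [f], and the high power of ['X] gives it the leading
   coefficient of [f], so that the resultant commutes with [ev]. *)
pose h := f * 'X^((size g).+1) + g.
have ltgh : (size g < size (f * 'X^((size g).+1))%R)%N.
  by rewrite size_mulXn // (leq_trans _ (leq_addr _ _)).
have Ih : I h by apply: ID => //; rewrite mulrC; apply: IM.
have lh : lead_coef h = lead_coef f.
  by rewrite lead_coefDl // lead_coef_Mmonic ?monicXn.
have szh : (1 < size h)%N.
  by rewrite size_polyDl // size_mulXn // addSn ltnS ltn_addl // ltnW.
have [[u v] _ /= Duv] := resultant_in_ideal szf szh.
have : ev (resultant f h) = 0.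
  by apply: Ia; rewrite Duv; apply: ID; apply: IM.
apply/eqP; rewrite rmorph_resultant ?lh // resultant_eq0 -leqNgt leqNgt.
apply/negP=> szgcd.
have /closed_rootP[b] : size (gcdp (map_poly ev f) (map_poly ev h)) != 1%N.
  by rewrite neq_ltn szgcd orbT.
rewrite root_gcd => /andP[/eqP fb0 /eqP]; rewrite rmorphD rmorphM /= hornerD.
by rewrite hornerM fb0 mul0r add0r; apply/eqP/g_rs/root_rs.
Qed.

(* The projection from [P^(n-1) x Spec A] to [Spec A] is closed, by elimination
   of one variable at a time.  Since [(0, ..., 0, 1)] is not a zero at [phi0],
   some homogeneous [f] in [I] has as leading coefficient in the last variable
   a scalar [c] with [phi0 c <> 0]. *)
Lemma projection_closed n (I : tower A n -> Prop) (phi0 : {rmorphism A -> L}) :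
    graded_ideal I -> no_proj_zero I phi0 ->
  exists2 r, phi0 r != 0 &
    forall phi : {rmorphism A -> L}, phi r != 0 -> no_proj_zero I phi.
Proof.
elim: n I => [|n IH] I gI nz0.
  by exists 1 => [|phi _ a _ k //]; rewrite rmorph1 oner_neq0.
have [[p0 Ip0] ID IM Ih] := gI.
pose e_n k : L := (k == n)%:R.
have [f [c [If lf c0 Df]]] : exists f c, [/\ I f, lead_coef f = tower_const n c,
    phi0 c != 0 & forall (phi : {rmorphism A -> L}) a,
     (forall k, (k < n)%N -> a k = 0) ->
       tower_eval phi a n.+1 f = phi c * a n ^+ (size f).-1].
  have [g Ig gn] : exists2 g, I g & tower_eval phi0 e_n n.+1 g != 0.
    apply: NNPP => no_g; have /eqP := oner_neq0 L; apply.
    rewrite -(nz0 e_n _ n) ?/e_n ?eqxx // => g Ig; apply: NNPP => gn.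
    by apply: no_g; exists g => //; apply/eqP.
  have [m /(_ m (leqnn m)) Dg] := sum_hom_part g.
  have [e ge] : exists e : 'I_m, tower_eval phi0 e_n n.+1 (hom_part e g) != 0.
    apply: NNPP => no_e; move/eqP: gn; apply.
    rewrite Dg rmorph_sum big1 // => e _.
    by apply: NNPP => ge; apply: no_e; exists e; apply/eqP.
  have [c Dc] := hom_part_deg0 (g : {poly tower A n})`_e.
  have Df (phi : {rmorphism A -> L}) a : (forall k, (k < n)%N -> a k = 0) ->
      tower_eval phi a n.+1 (hom_part e g) = phi c * a n ^+ e.
    move=> a0; rewrite tower_evalS (@horner_coef_wide _ e.+1); last first.
      exact: leq_trans (size_poly _ _) (size_poly _ _).
    rewrite big_ord_recr /= big1 ?add0r => [|i _].
      rewrite coef_map coef_poly ltnSn subnn Dc; congr (_ * _).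
      exact: tower_eval_const.
    rewrite coef_map coef_poly ltnS (ltnW (ltn_ord i)) /=.
    (* The first [n] coordinates are 0, so scaling them by 0 changes nothing, yet it kills parts of
       positive degree [e - i]. *)
    rewrite (@eq_tower_eval _ _ _ _ (fun k => 0 * a k)); last first.
      by move=> k /a0 ->; rewrite mul0r.
    by rewrite tower_eval_hom_part expr0n subn_eq0 leqNgt ltn_ord !mul0r.
  have c0 : phi0 c != 0.
    apply: contraNneq ge => c0; rewrite Df ?c0 ?mul0r // => k ltkn.
    by rewrite /e_n ltn_eqF.
  have sz : size (hom_part e g : {poly tower A n}) = e.+1.
    rewrite /= size_poly_eq // subnn Dc; apply: contraNneq c0 => c0.
    by rewrite -(tower_eval_const phi0 e_n n) c0 rmorph0.
  exists (hom_part e g), c; split=> //; first exact: Ih.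
    by rewrite lead_coefE sz coef_poly ltnSn subnn.
  by move=> phi a a0; rewrite sz Df.
have gI' : graded_ideal (fun q : tower A n => I q%:P).
  split=> [|p q Ip Iq|p q Iq|e p /(Ih e)]; last by rewrite hom_partC.
  - by exists 0; rewrite polyC0 -(mul0r p0); apply: IM.
  - by rewrite polyCD; apply: ID.
  - by rewrite polyCM; apply: IM.
have [a Ia k ltkn|r r0 nz] := IH _ gI'.
  have [b Ib] := extend_zero gI If lf c0 Ia.
  pose ab j := if j == n then b else a j.
  have <- : ab k = a k by rewrite /ab ltn_eqF.
  apply: nz0 (ltnW ltkn) => g Ig; rewrite -(Ib g Ig) tower_evalS.
  have -> : ab n = b by rewrite /ab eqxx.
  congr _.[b]; apply: eq_map_poly; apply: eq_tower_eval => j ltjn.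
  by rewrite /ab ltn_eqF.
(* [r] forces the first [n] coordinates of a zero to vanish; then [f] reduces to [phi c] times a
   power of the last coordinate and forces that one to vanish too. *)
exists (r * c) => [|phi]; first by rewrite rmorphM mulf_neq0.
rewrite rmorphM mulf_eq0 negb_or => /andP[/nz {}nz c1] a Ia.
have a0 k : (k < n)%N -> a k = 0.
  by apply: nz => p /Ia; rewrite tower_evalC.
move=> k; rewrite ltnS leq_eqVlt => /predU1P[->|/a0//].
have /eqP := Ia f If; rewrite (Df phi a a0) mulf_eq0 (negPf c1) expf_eq0.
by case/andP=> _ /eqP.
Qed.

End Elimination.

(** The value of [p] at [x * a] is a polynomial in [x] whose coefficients are the values at [a] of
    the homogeneous parts. If [p] vanishes on [Z], this polynomial vanishes at all naturals, hence
    is 0 in characteristic 0. *)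
Lemma graded_ideal_of_cone (A : comNzRingType) (L : closedFieldType) n
    (Z : {rmorphism A -> L} -> (nat -> L) -> Prop) :
  [pchar L] =i pred0 ->
  (forall phi a x, Z phi a -> Z phi (fun k => x * a k)) ->
  graded_ideal (fun p : tower A n =>
    forall phi a, Z phi a -> tower_eval phi a n p = 0).
Proof.
move=> L0 coneZ; split; first by exists 0 => phi a _; rewrite rmorph0.
- by move=> p q Ip Iq phi a Za; rewrite rmorphD /= Ip ?Iq ?addr0.
- by move=> p q Iq phi a Za; rewrite rmorphM /= Iq ?mulr0.
move=> e p Ip phi a Za.
have [m Dp] := sum_hom_part p.
pose P := \poly_(i < maxn m e.+1) tower_eval phi a n (hom_part i p).
have P0 : P = 0.
  apply/eqP; apply: NNPP => /negP nzP.
  have [i /eqP[]] := exists_nat_nonroot L0 nzP.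
  rewrite -(Ip phi _ (coneZ phi a i%:R Za)) [in RHS](Dp _ (leq_maxl m e.+1)).
  rewrite rmorph_sum horner_poly; apply: eq_bigr => j _ /=.
  by rewrite tower_eval_hom_part mulrC.
have := congr1 (fun P : {poly L} => P`_e) P0.
by rewrite coef_poly coef0 leq_maxr.
Qed.

(** One variable at a time: some coefficient in the last variable is nonzero at [y], hence at a
    natural point by induction, which leaves a nonzero polynomial in the last variable. *)
Lemma tower_exists_nat_nonzero (L : fieldType) n (y : nat -> L)
    (r : tower L n) :
  [pchar L] =i pred0 -> tower_eval idfun y n r != 0 ->
  exists t : nat -> nat, tower_eval idfun (fun k => (t k)%:R) n r != 0.
Proof.
move=> L0; elim: n r => [|n IH] r; first by exists (fun=> 0%N).
rewrite tower_evalS => r0.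
have [i ri0] : exists i, tower_eval idfun y n (r : {poly _})`_i != 0.
  apply: NNPP => nor; move/eqP: r0; apply.
  suff -> : map_poly (tower_eval idfun y n) r = 0 by rewrite horner0.
  apply/polyP=> i; rewrite coef_map coef0; apply: NNPP => ri0.
  by apply: nor; exists i; apply/eqP.
have [t rti0] := IH _ ri0.
have rt0 : map_poly (tower_eval idfun (fun k => (t k)%:R : L) n) r != 0.
  by apply: contraNneq rti0 => rt0; rewrite -coef_map rt0 coef0.
have [m rm0] := exists_nat_nonroot L0 rt0.
exists (fun k => if k == n then m else t k); rewrite tower_evalS eqxx.
rewrite (eq_map_poly (eq_tower_eval (b := fun k => (t k)%:R) _ _)) //.
by move=> k ltkn; rewrite ltn_eqF.
Qed.

(** * Evaluation of multivariate polynomials and specialisation of coefficients *)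

Lemma rmorph_mmap n (R S T : nzRingType) (ev : {rmorphism S -> T}) (f : R -> S)
    (h : 'I_n -> S) (p : {mpoly R[n]}) :
  ev (mmap f h p) = mmap (ev \o f) (ev \o h) p.
Proof.
rewrite /mmap rmorph_sum; apply: eq_bigr => m _; rewrite rmorphM; congr (_ * _).
by rewrite /mmap1 rmorph_prod; apply: eq_bigr => i _; rewrite rmorphXn.
Qed.

Lemma eq_mmap n (R S : nzRingType) (f g : R -> S) (h k : 'I_n -> S) :
  f =1 g -> h =1 k -> forall p : {mpoly R[n]}, mmap f h p = mmap g k p.
Proof.
move=> fg hk p; apply: eq_bigr => m _; rewrite fg; congr (_ * _).
by apply: eq_bigr => i _; rewrite hk.
Qed.

Lemma meval_map_mpoly n (R S : comNzRingType) (f : {rmorphism R -> S})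
    (x : 'I_n -> S) (p : {mpoly R[n]}) :
  (map_mpoly f p).@[x] = mmap f x p.
Proof.
rewrite /map_mpoly (rmorph_mmap (meval x)); apply: eq_mmap => c /=.
  by rewrite mevalC.
by rewrite mevalXU.
Qed.

Lemma mmap_homogZ n d (R : nzRingType) (S : comNzRingType) (f : R -> S)
    (h : 'I_n -> S) (x : S) (p : {mpoly R[n]}) :
  p \is d.-homog -> mmap f (fun i => x * h i) p = x ^+ d * mmap f h p.
Proof.
move=> /dhomogP hp; rewrite /mmap mulr_sumr; apply: eq_big_seq => m /hp.
rewrite -[LHS]/(mdeg m) => dm.
rewrite mulrCA; congr (_ * _); rewrite /mmap1 -dm mdegE -prodrXr -big_split.
by apply: eq_bigr => i _; rewrite exprMn.
Qed.

(** By [projection_closed], a Zariski open neighbourhood of [y] consists of coefficient vectors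
    without common zero. In characteristic 0 it contains a vector of naturals, which makes sense
    over [F] although [y] need not. *)
Lemma nat_combination_without_zero (N d m : nat) (F : fieldType)
    (L : closedFieldType) (iota : {rmorphism F -> L})
    (g : 'I_m -> poly_tuple N F)
    (y : 'I_m -> L) :
    [pchar L] =i pred0 -> (forall j i, g j i \is d.-homog) ->
    (forall x : 'cV[L]_N.+1, x != 0 ->
      \sum_j y j *: eval_tuple (Defs.map_tuple iota (g j)) x != 0) ->
  exists t : 'I_m -> nat, forall x : 'cV[L]_N.+1, x != 0 ->
    \sum_j (t j)%:R *: eval_tuple (Defs.map_tuple iota (g j)) x != 0.
Proof.
(* [A] is the ring of the unknown coefficients, and [G] is the generic combination of the [g j] over
   it. *)
move=> L0 hg nz_y; pose A := tower L m; pose n := N.+1.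
pose Gj j i : tower A n := mmap (tower_const n \o tower_const m \o iota)
  (fun k : 'I_n => tower_var A n k) (g j i).
pose G i := \sum_(j < m) tower_const n (tower_var L m j) * Gj j i.
have GE (phi : {rmorphism A -> L}) (a : nat -> L) i :
    tower_eval phi a n (G i) = \sum_(j < m) phi (tower_var L m j) *
      mmap (phi \o tower_const m \o iota) (fun k : 'I_n => a k) (g j i).
  rewrite rmorph_sum; apply: eq_bigr => j _.
  rewrite rmorphM rmorph_mmap; congr (_ * _); first exact: tower_eval_const.
  apply: eq_mmap => k; first exact: tower_eval_const.
  exact: tower_eval_var.
pose pt (a : nat -> L) : 'cV[L]_n := \col_k a k.
have GtE (t a : nat -> L) :
    (forall i, tower_eval (tower_eval idfun t m) a n (G i) = 0)
    <-> \sum_(j < m) t j *: eval_tuple (Defs.map_tuple iota (g j)) (pt a) = 0.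
  have E i : tower_eval (tower_eval idfun t m) a n (G i) =
      (\sum_(j < m) t j *: eval_tuple (Defs.map_tuple iota (g j)) (pt a)) i 0.
    rewrite GE summxE; apply: eq_bigr => j _.
    rewrite !mxE ffunE meval_map_mpoly.
    rewrite tower_eval_var //; congr (_ * _); apply: eq_mmap => k.
      exact: tower_eval_const.
    by rewrite mxE.
  split=> [G0|S0 i]; last by rewrite E S0 mxE.
  by apply/matrixP=> i k; rewrite ord1 -E G0 mxE.
(* Each [G i] lies in the ideal of all functions vanishing on [Z], so the zeros of that ideal are
   exactly [Z]. *)
pose Z (phi : {rmorphism A -> L}) a := forall i, tower_eval phi a n (G i) = 0.
have coneZ phi a x : Z phi a -> Z phi (fun k => x * a k).
  move=> Za i; have := Za i; rewrite !GE => /(congr1 ( *%R (x ^+ d))).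
  rewrite mulr0 mulr_sumr => S0; rewrite -[RHS]S0; apply: eq_bigr => j _.
  by rewrite (mmap_homogZ _ _ _ (hg j i)) mulrCA.
have gI := graded_ideal_of_cone n L0 coneZ.
pose y' k := if insub k is Some j then y j else 0.
have y'E (j : 'I_m) : y' j = y j by rewrite /y' valK.
have [|r r0 nz_r] := projection_closed L0 (phi0 := tower_eval idfun y' m) gI.
  move=> a Ia k ltkn.
  have Za : Z (tower_eval idfun y' m) a.
    by move=> i; apply: Ia => phi b; apply.
  have /GtE S0 := Za; have [pa0|/nz_y/eqP[]] := eqVneq (pt a) 0.
    by have /matrixP/(_ (Ordinal ltkn) 0) := pa0; rewrite !mxE.
  by rewrite -[RHS]S0; apply: eq_bigr => j _; rewrite y'E.
have [t rt0] := tower_exists_nat_nonzero L0 r0.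
exists (fun j => t j) => x; apply: contraNneq => S0.
have /nz_r nz := rt0; pose a k := x (inord k) 0.
have Dx : pt a = x by apply/matrixP=> i k; rewrite ord1 mxE /a inord_val.
apply/eqP/matrixP=> i k; rewrite ord1 mxE -Dx mxE; apply: nz (ltn_ord i).
by move=> p; apply; apply/GtE; rewrite Dx.
Qed.

(** * Galois descent of point configurations *)

Lemma fixed_by_aut_mem (S : splittingFieldType rat) (k : {subfield S}) (x : S) :
  (forall g : {rmorphism S -> S}, {in k, forall y, g y = y} -> g x = x) ->
  x \in k.
Proof.
move=> fix_x; have galS : galois k {:S}.
  rewrite /galois subvf normalFieldf andbT; apply/separableP=> y _.
  apply: pcharf0_separable => q; have := pchar_num rat q; rewrite !inE.
  by rewrite -(rmorph_nat (in_alg S)) fmorph_eq0.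
have/galois_fixedField <- := galS; apply/fixedFieldP=> [|g g_gal].
  exact: memvf.
by apply: fix_x => y ky; apply: (fixed_gal (subvf k) g_gal).
Qed.

(** Both [x] and the image of [K] lie in a number field normal over the rationals. Galois theory
    applies there, and its automorphisms extend to [algC]. *)
Lemma fixed_by_aut_num_field (K : fieldExtType rat)
    (iota : {rmorphism K -> algC}) (x : algC) :
  (forall s : {rmorphism algC -> algC}, bijective s ->
     (forall y, s (iota y) = iota y) -> s x = x) ->
  exists y, x = iota y.
Proof.
move=> fix_x; pose b := vbasis {:K}; pose xs := x :: map iota b.
have [p p0 rp] : exists2 p : {poly rat}, p != 0 &
    forall z, z \in xs -> root (map_poly ratr p) z.
  elim: xs => [|z xs [p p0 rp]]; first by exists 1 => //; apply: oner_neq0.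
  have [q [_ qm] qz] := minCpolyP z.
  exists (q * p) => [|t]; first by rewrite mulf_neq0 // monic_neq0.
  rewrite rmorphM rootM inE => /predU1P[->|/rp ->]; last by rewrite orbT.
  by rewrite qz dvdpp.
have [rs Drs] := closed_field_poly_normal (map_poly ratr p : {poly algC}).
have lp0 : lead_coef (map_poly ratr p : {poly algC}) != 0.
  by rewrite lead_coef_eq0 map_poly_eq0.
have xs_rs z : z \in xs -> z \in rs.
  by move=> /rp; rewrite Drs rootZ ?root_prod_XsubC.
have [Q [QC [ss Dss genQ]]] := num_field_exists rs.
have lift z : z \in xs -> exists y, z = QC y.
  by move=> /xs_rs; rewrite -Dss => /mapP[y _ ->]; exists y.
have [x' Dx] : exists y, x = QC y by apply: lift; rewrite mem_head.
have [b' Db'] : exists b' : 'I_(\dim {:K}) -> Q,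
    forall i, QC (b' i) = iota b`_i.
  have lb i : exists y, QC y == iota b`_(i : 'I_(\dim {:K})).
    have [|y ->] := lift (iota b`_i); last by exists y.
    by rewrite inE map_f ?orbT // mem_nth // size_tuple.
  by exists (fun i => xchoose (lb i)) => i; apply/eqP/(xchooseP (lb i)).
(* The copy of [K] inside [Q]. *)
pose k : {vspace Q} := (\sum_i <[b' i]>)%VS.
have memk y : reflect (exists z, QC y = iota z) (y \in k).
  apply: (iffP idP) => [/memv_sumP[c kc ->]|[z Dy]].
    have ck i : exists a, c i == a *: b' i.
      by have /vlineP[a ->] := kc i isT; exists a.
    exists (\sum_i xchoose (ck i) *: b`_i); rewrite !rmorph_sum /=.
    apply: eq_bigr => i _.
    move: (xchoose _) (xchooseP (ck i)) => a /eqP->.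
    by rewrite !rmorphZ_num Db'.
  apply/memv_sumP; exists (fun i => coord b i z *: b' i) => [i _|].
    by rewrite memvZ ?memv_line.
  apply: (fmorph_inj QC); rewrite Dy {1}(coord_vbasis (memvf z)) !rmorph_sum.
  by apply: eq_bigr => i _; rewrite /= !rmorphZ_num Db'.
have algk : is_aspace k.
  rewrite /is_aspace has_algid1; last first.
    by apply/memk; exists 1; rewrite !rmorph1.
  apply/prodvP=> y z /memk[y1 Dy] /memk[z1 Dz]; apply/memk.
  by exists (y1 * z1); rewrite !rmorphM Dy Dz.
have Drs' : map_poly (in_alg Q) p %= \prod_(z <- ss) ('X - z%:P).
  rewrite -(eqp_map QC).
  rewrite -map_poly_comp (@eq_map_poly _ _ _ ratr); last first.
    by move=> a /=; rewrite rmorphZ_num rmorph1 mulr1.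
  rewrite Drs -Dss big_map rmorph_prod /=.
  rewrite [X in _ %= X](eq_bigr (fun z => 'X - (QC z)%:P)); last first.
    by move=> z _; rewrite /= map_polyXsubC.
  by rewrite eqp_scale.
have splitQ : splitting_field_axiom Q.
  exists (map_poly (in_alg Q) p); last by exists ss.
  by apply/polyOverP=> i; rewrite coef_map memvZ ?memv_line.
pose QM := FieldExt_isSplittingField.Build rat Q splitQ.
pose S : splittingFieldType rat := HB.pack Q QM.
pose kS : {subfield S} := ASpace algk.
suff : (x' : S) \in kS by move=> /memk[z Dz]; exists z; rewrite Dx.
apply: fixed_by_aut_mem => g g_fix.
have [nu Dnu] := extend_algC_subfield_aut (QC : {rmorphism S -> algC}) g.
apply: (fmorph_inj QC); rewrite Dnu -Dx fix_x //.
  by exists (algC_invaut nu); [apply: algC_autK | apply: algC_invautK].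
move=> z; pose y : Q := \sum_i coord b i z *: b' i.
have Dy : QC y = iota z.
  rewrite [in RHS](coord_vbasis (memvf z)) !rmorph_sum.
  by apply: eq_bigr => i _; rewrite /= !rmorphZ_num Db'.
rewrite -Dy -Dnu g_fix //.
by apply/memk; exists z.
Qed.

(* Induction on the set [B] of entries not yet known to be fixed.  The nonzero
   entries outside [B] are the edges of a bipartite graph on [V + I], along which
   [a] and [b^-1] agree, so an entry whose row and column are connected is fixed.
   Otherwise rescaling the connected component of the row makes this entry 1
   and preserves the entries outside [B]. *)
Lemma rescale_to_fixed (V I : finType) (L : fieldType)
    (S : {rmorphism L -> L} -> Prop) (X : V -> I -> L) :
    (forall s, S s -> exists (a : V -> L) (b : I -> L),
      [/\ forall v, a v != 0, forall i, b i != 0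
        & forall v i, s (X v i) = a v * X v i * b i]) ->
  exists (a : V -> L) (b : I -> L),
    [/\ forall v, a v != 0, forall i, b i != 0
      & forall s, S s -> forall v i,
          s (a v * X v i * b i) = a v * X v i * b i].
Proof.
have [m] := ubnP #|[set: V * I]|.
have : forall e, e \notin [set: V * I] ->
    forall s, S s -> s (X e.1 e.2) = X e.1 e.2.
  by move=> e; rewrite inE.
elim: m [set: V * I] X => // m IH B X BX leBm SX.
case: (classic (forall s, S s -> forall v i, s (X v i) = X v i)) => [fixX|].
  exists (fun=> 1), (fun=> 1); split=> [v|i|s Ss v i]; rewrite ?oner_neq0 //.
  by rewrite mul1r mulr1 fixX.
move=> not_fix; have [v [i [s0 [S0 s0X]]]] :
    exists v i s, S s /\ s (X v i) <> X v i.
  apply: NNPP => no; apply: not_fix => s Ss v i; apply: NNPP => sX.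
  by apply: no; exists v, i, s.
have Bvi : (v, i) \in B.
  by apply: contraT => /BX/(_ s0 S0).
have X0 : X v i != 0.
  by apply: contra_notN s0X => /eqP->; rewrite rmorph0.
pose edge (u w : V + I) := match u, w with
  | inl v, inr i | inr i, inl v => ((v, i) \notin B) && (X v i != 0)
  | _, _ => false end.
have not_conn : ~~ connect edge (inl v) (inr i).
  apply: contra_notN s0X => vi; have [a [b [a0 b0 sX]]] := SX s0 S0.
  pose c (u : V + I) := match u with inl v => a v | inr i => (b i)^-1 end.
  have c_edge u w : edge u w -> c u = c w.
    have ab w' j : (w', j) \notin B -> X w' j != 0 -> a w' = (b j)^-1.
      move=> /BX/(_ s0 S0) /=; rewrite sX => fixX Xn0.
      apply: (mulIf (b0 j)); rewrite mulVf //; apply: (mulIf Xn0).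
      by rewrite mul1r -[RHS]fixX mulrAC.
    by case: u w => [u|u] [w|w] //= /andP[/ab h /h].
  have : c (inl v) = c (inr i).
    case/connectP: vi => p pth ->; elim: p (inl v) pth => //= w p IHp u.
    by case/andP=> /c_edge -> /IHp.
  by rewrite sX /= => ->; rewrite mulrAC mulVf ?mul1r.
pose t := (X v i)^-1; have t0 : t != 0 by rewrite invr_eq0.
pose a0 w := if connect edge (inl v) (inl w) then t else 1.
pose b0 j := if connect edge (inl v) (inr j) then t^-1 else 1.
have a0n0 w : a0 w != 0 by rewrite /a0; case: ifP; rewrite ?oner_neq0.
have b0n0 j : b0 j != 0 by rewrite /b0; case: ifP; rewrite ?invr_eq0 ?oner_neq0.
pose X' w j := a0 w * X w j * b0 j.
have [||s Ss|a [b [an0 bn0 sab]]] := IH (B :\ (v, i)) X'.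
- move=> [w j]; rewrite !inE negb_and negbK => eB s Ss /=.
  have [[-> ->]|ne] := eqVneq (w, j) (v, i).
    by rewrite /X' /a0 /b0 connect0 (negPf not_conn) mulVf // mulr1 rmorph1.
  move: eB; rewrite (negPf ne) /= => eB; have fixX := BX _ eB s Ss.
  have [Xwj|Xwj] := eqVneq (X w j) 0.
    by rewrite /X' Xwj mulr0 mul0r rmorph0.
  suff -> : X' w j = X w j by [].
  have ewj : edge (inl w) (inr j) by rewrite /= eB.
  have ejw : edge (inr j) (inl w) by rewrite /= eB.
  rewrite /X' /a0 /b0.
  have -> : connect edge (inl v) (inr j) = connect edge (inl v) (inl w).
    by apply/idP/idP => h; apply: connect_trans h (connect1 _).
  by case: ifP => _; rewrite ?mul1r ?mulr1 // mulrAC mulfV ?mul1r.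
- by rewrite (cardsD1 (v, i) B) Bvi in leBm.
- have [a [b [an0 bn0 sX]]] := SX s Ss.
  (* Rescaling by [a0] and [b0] twists the factors of [X] by [s (a0 w) / a0 w] and
     [s (b0 j) / b0 j]. *)
  exists (fun w => s (a0 w) * a w / a0 w), (fun j => s (b0 j) * b j / b0 j).
  split=> [w|j|w j].
  + by rewrite !mulf_neq0 ?invr_eq0 ?fmorph_eq0.
  + by rewrite !mulf_neq0 ?invr_eq0 ?fmorph_eq0.
  rewrite /X' !rmorphM sX; have := a0n0 w; have := b0n0 j.
  move: (s (a0 w)) (s (b0 j)) (a0 w) (b0 j) => a1 b1 a2 b2 b20 a20.
  by field; rewrite a20 b20.
exists (fun w => a w * a0 w), (fun j => b0 j * b j); split=> [w|j|s Ss w j].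
- by rewrite mulf_neq0.
- by rewrite mulf_neq0.
have -> : a w * a0 w * X w j * (b0 j * b j) = a w * X' w j * b j.
  by rewrite /X' !mulrA.
exact: sab.
Qed.

(** Let [X] hold the coordinates of the vectors in a basis [E] chosen among them. Since [s]
    multiplies [E] by [B] on the right and by a diagonal matrix on the left, it only rescales rows
    and columns of [X], so [rescale_to_fixed] applies. *)
Lemma fixed_coordinates (V : finType) n (L : fieldType)
    (S : {rmorphism L -> L} -> Prop) (p : V -> 'rV[L]_n) :
    (forall s, S s -> exists (a : V -> L) (B : 'M_n),
      [/\ forall v, a v != 0, B \in unitmx
        & forall v, map_mx s (p v) = a v *: (p v *m B)]) ->
  exists (a : V -> L) (M : 'M_n),
    [/\ forall v, a v != 0, M \in unitmx
      & forall s, S s -> forall v,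
          map_mx s (a v *: (p v *m M)) = a v *: (p v *m M)].
Proof.
move=> Sp; pose P := \matrix_(i < #|V|) p (enum_val i).
pose f := maxrankfun P; pose r : nat := \rank P.
pose E : 'M[L]_(r, n) := rowsub f P.
have fE : row_free E := maxrowsub_free P.
pose X v : 'rV[L]_r := p v *m pinvmx E.
have pE v : p v = X v *m E.
  rewrite mulmxKpV // (eq_maxrowsub P).
  by rewrite -[v]enum_rankK -(rowK (fun i => p (enum_val i))) row_sub.
pose w (j : 'I_r) := enum_val (f j).
have rE j : row j E = p (w j) by rewrite row_rowsub rowK.
have [s Ss|a [b [a0 b0 sX]]] :=
    @rescale_to_fixed V 'I_r L S (fun v j => X v 0 j).
  have [a [B [a0 uB sp]]] := Sp s Ss.
  exists a, (fun j => (a (w j))^-1).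
  split=> [//|j|v j]; first by rewrite invr_eq0.
  pose D := diag_mx (\row_j a (w j)).
  have sE : map_mx s E = D *m (E *m B).
    apply/row_matrixP=> i; rewrite -map_row rE sp row_mul row_diag_mx mxE.
    by rewrite -scalemxAl -rowE row_mul rE.
  have fEB : row_free (E *m B).
    by rewrite /row_free mxrankMfree ?row_free_unit.
  have : map_mx s (X v) *m D = a v *: X v.
    apply: (row_free_inj fEB); rewrite -mulmxA -sE -map_mxM -pE sp pE.
    by rewrite -scalemxAl mulmxA.
  move=> /rowP/(_ j); rewrite mul_mx_diag !mxE => sXD.
  by rewrite -sXD mulfK.
pose Y v : 'rV[L]_r := \row_j (a v * X v 0 j * b j).
pose E' := diag_mx (\row_j (b j)^-1) *m E.
have lern : (r <= n)%N := rank_leq_col P.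
(* [Y v] are the coordinates of [a v *: p v] in the rescaled basis [E']. The invertible matrix [M]
   maps the first [r] unit vectors, which every [s] fixes, to [E']. *)
pose U : 'M[L]_(r, n) := pid_mx r.
have UE : U *m ((pid_mx r : 'M[L]_(n, r)) *m E') = E'.
  by rewrite mulmxA pid_mx_id // pid_mx_1 mul1mx.
have rE' : \rank E' = r.
  rewrite eqmxMfull; first exact/eqP.
  rewrite row_full_unit unitmxE det_diag unitfE; apply/prodf_neq0 => j _.
  by rewrite mxE invr_eq0.
have [|M uM UM] := @complete_unitmx _ _ _ U ((pid_mx r : 'M[L]_(n, r)) *m E').
  by rewrite UE rE' rank_pid_mx.
exists a, (invmx M); split=> [||s Ss v] //; first by rewrite unitmx_inv.
have -> : a v *: (p v *m invmx M) = Y v *m U.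
  have -> : U = E' *m invmx M by rewrite -UE UM mulmxK.
  rewrite !mulmxA scalemxAl; congr (_ *m _).
  rewrite pE scalemxAl; congr (_ *m _); apply/rowP=> j.
  by rewrite mul_mx_diag !mxE mulfK.
rewrite map_mxM map_pid_mx; congr (_ *m _).
by apply/rowP=> j; rewrite mxE [Y v 0 j]mxE; apply: sX.
Qed.

(** * Endomorphisms of projective space *)

(** Kernels commute with field extension, so a solution over [L] of a system over [K] is a
    combination of solutions over [K], here the rows of [kermx M]. *)
Lemma linear_descent (T W : finType) (K L : fieldType)
    (iota : {rmorphism K -> L}) (R : T -> W -> K) (c : T -> L) :
    (forall w, \sum_t c t * iota (R t w) = 0) ->
  exists n (y : 'I_n -> L) (b : 'I_n -> T -> K),
    (forall t, c t = \sum_j y j * iota (b j t)) /\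
    (forall j w, \sum_t b j t * R t w = 0).
Proof.
move=> Rc; pose M := \matrix_(i < #|T|, j < #|W|) R (enum_val i) (enum_val j).
pose u := \row_(i < #|T|) c (enum_val i).
have sum_enum (F : zmodType) (G : T -> F) :
    \sum_(i < #|T|) G (enum_val i) = \sum_t G t.
  rewrite [RHS](reindex (@enum_val T T)) //.
  exact/onW_bij/enum_val_bij.
have /submxP[y Dy] : (u <= map_mx iota (kermx M))%MS.
  rewrite map_kermx; apply/sub_kermxP/rowP=> j; rewrite !mxE.
  rewrite -[RHS](Rc (enum_val j)) -sum_enum; apply: eq_bigr => i _.
  by rewrite !mxE.
exists #|T|, (fun j => y 0 j), (fun j t => kermx M j (enum_rank t)).
split=> [t|j w].
  have /rowP/(_ (enum_rank t)) := Dy; rewrite !mxE enum_rankK => ->.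
  by apply: eq_bigr => j _; rewrite mxE.
have /matrixP/(_ j (enum_rank w)) := mulmx_ker M.
rewrite !mxE => E; rewrite -[RHS]E -sum_enum; apply: eq_bigr => i _.
by rewrite !mxE enum_valK enum_rankK.
Qed.

Lemma homog_meval n d (R : comNzRingType) (p : {mpoly R[n]}) (x : 'I_n -> R) :
  p \is d.-homog -> p.@[x] =
    \sum_(m : 'X_{1..n < d.+1} | mdeg m == d) p@_m * \prod_i x i ^+ m i.
Proof.
move=> hp; have szp : (msize p <= d.+1)%N.
  by rewrite msizeE; apply/bigmax_leqP_seq => m mp _; rewrite (dhomog_mf hp mp).
rewrite {1}(mpolywE szp) raddf_sum [RHS]big_mkcond /=; apply: eq_bigr => m _.
rewrite mevalZ mevalX; case: ifPn => // dm.
by rewrite (dhomog_nemf_coeff hp dm) mul0r.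
Qed.

Lemma eval_homogZ (N d : nat) (F : fieldType) (f : poly_tuple N F) (c : F)
    (x : 'cV[F]_N.+1) :
  (forall i, f i \is d.-homog) ->
  eval_tuple f (c *: x) = c ^+ d *: eval_tuple f x.
Proof.
move=> hf; apply/colP=> i; rewrite !mxE -(mmap_homogZ _ _ _ (hf i)).
by apply: eq_mmap => // j; rewrite mxE.
Qed.

Lemma eval_map_tuple (N : nat) (F F' : fieldType) (s : {rmorphism F -> F'})
    (f : poly_tuple N F) (x : 'cV[F]_N.+1) :
  eval_tuple (Defs.map_tuple s f) (map_mx s x) = map_mx s (eval_tuple f x).
Proof.
apply/colP=> i; rewrite !mxE ffunE meval_map_mpoly /meval rmorph_mmap.
by apply: eq_mmap => // j; rewrite mxE.
Qed.

Lemma map_tuple_id (N : nat) (F : fieldType) (f : poly_tuple N F) :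
  Defs.map_tuple (idfun : {rmorphism F -> F}) f = f.
Proof.
by apply/ffunP=> i; rewrite ffunE; apply/mpolyP=> m; rewrite mcoeff_map_mpoly.
Qed.

Lemma map_tuple_comp (N : nat) (F F' F'' : fieldType)
    (s : {rmorphism F -> F'}) (s' : {rmorphism F' -> F''})
    (s'' : {rmorphism F -> F''}) (f : poly_tuple N F) :
  (forall x, s' (s x) = s'' x) ->
  Defs.map_tuple s' (Defs.map_tuple s f) = Defs.map_tuple s'' f.
Proof.
move=> ss; apply/ffunP=> i; rewrite !ffunE; apply/mpolyP=> m.
by rewrite !mcoeff_map_mpoly /= ss.
Qed.

Lemma eval_neq0 (N d : nat) (F L : fieldType) (iota : {rmorphism F -> L})
    (f : poly_tuple N F) (x : 'cV[F]_N.+1) :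
  is_endo d iota f -> x != 0 -> eval_tuple f x != 0.
Proof.
move=> [_ nz] x0.
have : eval_tuple (Defs.map_tuple iota f) (map_mx iota x) != 0.
  by apply: nz; rewrite map_mx_eq0.
by rewrite eval_map_tuple map_mx_eq0.
Qed.

Lemma coords_proj_pt (N : nat) (F : fieldType) (x : 'cV[F]_N.+1) :
  x != 0 -> exists2 c, c != 0 & coords (proj_pt x) = c *: x.
Proof. by move=> x0; apply/proj_ptP; rewrite ?coords_neq0 ?coordsK. Qed.

Lemma endo_map_proj_pt (N d : nat) (F L : fieldType)
    (iota : {rmorphism F -> L}) (f : poly_tuple N F) (x : 'cV[F]_N.+1) :
  is_endo d iota f -> x != 0 ->
  endo_map f (proj_pt x) = proj_pt (eval_tuple f x).
Proof.
move=> ef x0; have [c c0 Dc] := coords_proj_pt x0.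
apply/proj_ptP; rewrite ?(eval_neq0 ef) ?coords_neq0 //.
exists (c ^- d); rewrite ?invr_eq0 ?expf_neq0 // Dc (eval_homogZ _ _ ef.1).
by rewrite scalerA mulVf ?scale1r ?expf_neq0.
Qed.

Lemma eval_conj_tuple (N : nat) (F : fieldType) (A : 'M[F]_N.+1)
    (f : poly_tuple N F) (x : 'cV[F]_N.+1) :
  eval_tuple (conj_tuple A f) x = invmx A *m eval_tuple f (A *m x).
Proof.
apply/colP=> i; rewrite !mxE ffunE raddf_sum; apply: eq_bigr => j _.
rewrite /= mevalZ mxE comp_mpoly_meval; congr (_ * _); apply: meval_eq => k.
rewrite tnth_mktuple raddf_sum mxE; apply: eq_bigr => l _.
by rewrite /= mevalZ mevalXU.
Qed.

Lemma conj_tuple_homog (N d : nat) (F : fieldType) (A : 'M[F]_N.+1)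
    (f : poly_tuple N F) :
  (forall i, f i \is d.-homog) -> forall i, conj_tuple A f i \is d.-homog.
Proof.
move=> hf i; rewrite ffunE; apply: rpred_sum => j _; apply: rpredZ.
rewrite comp_mpolyE big_seq; apply: rpred_sum => m mf; apply: rpredZ.
rewrite -(dhomog_mf (hf j) mf) /= mdegE.
apply: (big_ind2 (fun p e => p \is e.-homog)) => [|p e q e'|k _].
- exact: dhomog1.
- exact: dhomogM.
have lin1 : tnth (linear_forms A) k \is 1%N.-homog.
  rewrite tnth_mktuple; apply: rpred_sum => l _; apply: rpredZ.
  by rewrite dhomogX /= mdeg1.
by rewrite -[X in X.-homog]mul1n; apply: dhomogMn.
Qed.

(** The vanishing of the 2 by 2 minors expresses proportionality to [y] by equations linear in [x],
    which suit linear descent and transfer along field embeddings. *)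
Lemma colinearP n (F : fieldType) (x y : 'cV[F]_n) : y != 0 ->
  (exists c, x = c *: y) <-> (forall i j, x i 0 * y j 0 = x j 0 * y i 0).
Proof.
move=> y0; split=> [[c ->] i j|xy].
  by rewrite !mxE mulrAC.
have [k yk] : exists k, y k 0 != 0.
  apply: NNPP => no; move/eqP: y0; apply; apply/colP=> k; rewrite mxE.
  by apply: NNPP => yk; apply: no; exists k; apply/eqP.
exists (x k 0 / y k 0); apply/colP=> i; rewrite mxE; apply: (mulIf yk).
by rewrite xy mulrAC divfK.
Qed.

Lemma iter_repeats (V : finType) (Phi : V -> V) (v : V) :
  exists m n, (m < n)%N /\ iter m Phi v = iter n Phi v.
Proof.
pose it (i : 'I_#|V|.+1) := iter i Phi v.
have /injectivePn[i [j ij itij]] : ~~ injectiveb it.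
  by apply/injectiveP => /leq_card; rewrite card_ord ltnn.
wlog ltij : i j ij itij / (i < j)%N => [hw|]; last by exists i, j.
have [ltij|leji] := ltnP i j; first exact: hw itij ltij.
apply: (hw j i); rewrite 1?eq_sym // ltn_neqAle leji andbT.
by rewrite eq_sym; apply: contraNneq ij => /val_inj ->.
Qed.

Lemma descend_portrait (N d : nat) (K : fieldType) (L : closedFieldType)
    (iota : {rmorphism K -> L}) (V : finType) (Phi : V -> V)
    (q : V -> 'cV[K]_N.+1) (h : poly_tuple N L) :
    [pchar L] =i pred0 -> is_endo d (idfun : {rmorphism L -> L}) h ->
    (forall v, q v != 0) ->
    (forall v, exists c, eval_tuple h (map_mx iota (q v)) =
                         c *: map_mx iota (q (Phi v))) ->
  exists2 g : poly_tuple N K, is_endo d iota g &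
    forall v, exists c, eval_tuple g (q v) = c *: q (Phi v).
Proof.
move=> L0 [hh nz_h] q0 hq; pose n := N.+1.
pose T : finType := ('I_n * 'X_{1..n < d.+1})%type.
pose mon (F : fieldType) (x : 'cV[F]_n) (m : 'X_{1..n < d.+1}) :=
  \prod_i x i 0 ^+ m i.
(* [wedge x i j k] is the coefficient of [y k 0] in the minor [y i 0 * x j 0 - y j 0 * x i 0]. Thus
   [R t (v, i, j)] is the coefficient of the unknown [t] in the equation saying that the minor of
   the value at [q v] against [q (Phi v)] is 0. *)
pose wedge (F : fieldType) (x : 'cV[F]_n) (i j k : 'I_n) :=
  (k == i)%:R * x j 0 - (k == j)%:R * x i 0.
pose R (t : T) (w : V * 'I_n * 'I_n) := if mdeg t.2 == d then
  mon K (q w.1.1) t.2 * wedge K (q (Phi w.1.1)) w.1.2 w.2 t.1 else 0.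
have sum_wedge (F : fieldType) (y x : 'cV[F]_n) i j :
    \sum_k y k 0 * wedge F x i j k = y i 0 * x j 0 - y j 0 * x i 0.
  have delta l z : \sum_k y k 0 * ((k == l)%:R * z) = y l 0 * z.
    rewrite (bigD1 l) //= eqxx mul1r big1 ?addr0 // => k /negPf ->.
    by rewrite mul0r mulr0.
  rewrite -!delta -sumrB; apply: eq_bigr => k _.
  by rewrite mulrBr.
have sumT (F : fieldType) (c : T -> F) (x : 'cV[F]_n) (W : 'I_n -> F) :
    \sum_(t : T) c t * (if mdeg t.2 == d then mon F x t.2 * W t.1 else 0) =
    \sum_k (\sum_(m : 'X_{1..n < d.+1} | mdeg m == d) c (k, m) * mon F x m) * W k.
  rewrite (eq_bigr (fun t : T => (fun k m => c (k, m) * (if mdeg m == d then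
     mon F x m * W k else 0)) t.1 t.2)); last by case.
  rewrite -(pair_bigA _ (fun k (m : 'X_{1..n < d.+1}) => c (k, m) *
     (if mdeg m == d then mon F x m * W k else 0))) /=.
  apply: eq_bigr => k _; rewrite mulr_suml [RHS]big_mkcond; apply: eq_bigr => m _.
  by case: ifP => _; rewrite ?mulr0 // mulrA.
have map_mon x m : mon L (map_mx iota x) m = iota (mon K x m).
  by rewrite rmorph_prod; apply: eq_bigr => i _; rewrite mxE rmorphXn.
have map_wedge x i j k :
    wedge L (map_mx iota x) i j k = iota (wedge K x i j k).
  by rewrite rmorphB !rmorphM !rmorph_nat /wedge !mxE.
pose c (t : T) := (h t.1)@_t.2.
have Rc w : \sum_t c t * iota (R t w) = 0.
  case: w => [[v i] j]; pose qL u := map_mx iota (q u).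
  transitivity (\sum_k eval_tuple h (qL v) k 0 * wedge L (qL (Phi v)) i j k).
    rewrite (eq_bigr (fun t : T => c t * (if mdeg t.2 == d then
      mon L (qL v) t.2 * wedge L (qL (Phi v)) i j t.1 else 0))).
      rewrite sumT; apply: eq_bigr => k _; congr (_ * _).
      by rewrite mxE (homog_meval _ (hh k)).
    move=> t _; rewrite /R; case: ifP => _; rewrite ?rmorph0 // rmorphM map_mon.
    by rewrite map_wedge.
  rewrite sum_wedge; apply/eqP; rewrite subr_eq0; apply/eqP.
  by move: i j; apply/colinearP; rewrite ?map_mx_eq0 //; apply: hq.
(* [h] is an [L]-linear combination of tuples [g j] over [K] which satisfy the
   same linear conditions. *)
have [e [y [b [Dc Rb]]]] := linear_descent Rc.
pose g j : poly_tuple N K :=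
  [ffun i => \sum_(m : 'X_{1..n < d.+1} | mdeg m == d) b j (i, m) *: 'X_[m]].
have hg j i : g j i \is d.-homog.
  by rewrite ffunE; apply: rpred_sum => m dm; apply: rpredZ; rewrite dhomogX.
have gE j (x : 'cV[K]_n) i : eval_tuple (g j) x i 0 =
    \sum_(m : 'X_{1..n < d.+1} | mdeg m == d) b j (i, m) * mon K x m.
  by rewrite mxE ffunE raddf_sum; apply: eq_bigr => m _; rewrite /= mevalZ mevalX.
have gLE j (x : 'cV[L]_n) i : eval_tuple (Defs.map_tuple iota (g j)) x i 0 =
    \sum_(m : 'X_{1..n < d.+1} | mdeg m == d) iota (b j (i, m)) * mon L x m.
  rewrite mxE !ffunE (raddf_sum (map_mpoly iota)) raddf_sum; apply: eq_bigr => m _ /=.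
  by rewrite map_mpolyZ map_mpolyX mevalZ mevalX.
have [x x0|t nz_t] := @nat_combination_without_zero _ _ _ _ _ iota g y L0 hg.
  suff -> : \sum_j y j *: eval_tuple (Defs.map_tuple iota (g j)) x = eval_tuple h x.
    by rewrite -(map_tuple_id h) nz_h.
  apply/colP=> i; rewrite summxE [RHS]mxE (homog_meval _ (hh i)).
  rewrite (eq_bigr (fun m : 'X_{1..n < d.+1} =>
    \sum_j y j * (iota (b j (i, m)) * mon L x m))).
    rewrite exchange_big; apply: eq_bigr => j _.
    by rewrite mxE gLE mulr_sumr.
  move=> m _; rewrite -[_@__]/(c (i, m)) Dc mulr_suml; apply: eq_bigr => j _.
  by rewrite mulrA.
pose gt : poly_tuple N K := [ffun i => \sum_j (t j)%:R *: g j i].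
exists gt; first split=> [i|x x0].
- by rewrite ffunE; apply: rpred_sum => j _; apply: rpredZ; apply: hg.
- suff -> : eval_tuple (Defs.map_tuple iota gt) x =
      \sum_j (t j)%:R *: eval_tuple (Defs.map_tuple iota (g j)) x by apply: nz_t.
  apply/colP=> i; rewrite summxE !mxE !ffunE (raddf_sum (map_mpoly iota)) raddf_sum.
  apply: eq_bigr => j _ /=.
  rewrite map_mpolyZ mevalZ rmorph_nat !mxE.
  by rewrite [Defs.map_tuple _ _ _]ffunE.
move=> v; apply/colinearP => // i j.
have gtE k : eval_tuple gt (q v) k 0 = \sum_l (t l)%:R * eval_tuple (g l) (q v) k 0.
  rewrite mxE ffunE raddf_sum; apply: eq_bigr => l _.
  by rewrite /= mevalZ mxE.
rewrite !gtE !mulr_suml; apply: eq_bigr => l _; rewrite -!mulrA; congr (_ * _).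
apply/eqP; rewrite -subr_eq0 -sum_wedge -[X in _ == X](Rb l (v, i, j)).
by rewrite sumT; apply/eqP; apply: eq_bigr => k _; rewrite gE.
Qed.

(** * Portraits and moduli points *)

Lemma proj_pt_eqP (N : nat) (F : fieldType) (x y : 'cV[F]_N.+1) :
  x != 0 -> y != 0 ->
  proj_pt x = proj_pt y <-> exists c : F, x = c *: y.
Proof.
move=> x0 y0; split=> [/esym/(proj_ptP y0 x0)[c _ ->]|[c Dx]]; first by exists c.
apply/esym/(proj_ptP y0 x0); exists c => //; apply: contraNneq x0 => c0.
by rewrite Dx c0 scale0r.
Qed.

Lemma map_proj_pt (N : nat) (F F' : fieldType) (s : {rmorphism F -> F'})
    (x : 'cV[F]_N.+1) : x != 0 ->
  proj_pt (map_mx s (coords (proj_pt x))) = proj_pt (map_mx s x).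
Proof.
move=> x0; have [c c0 ->] := coords_proj_pt x0.
apply/proj_pt_eqP; rewrite ?map_mx_eq0 ?scaler_eq0 ?negb_or ?c0 //.
by exists (s c); rewrite map_mxZ.
Qed.

Lemma map_proj_pt_inj (N : nat) (F F' : fieldType) (s : {rmorphism F -> F'})
    (x y : 'cV[F]_N.+1) : x != 0 -> y != 0 ->
  proj_pt (map_mx s x) = proj_pt (map_mx s y) -> proj_pt x = proj_pt y.
Proof.
move=> x0 y0 /proj_pt_eqP; rewrite !map_mx_eq0 => /(_ x0 y0) sxy.
apply/proj_pt_eqP => //; apply/colinearP => // i j; apply: (fmorph_inj s).
have sy0 : map_mx s y != 0 by rewrite map_mx_eq0.
by have /(colinearP _ sy0)/(_ i j) := sxy; rewrite !mxE !rmorphM.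
Qed.

Lemma portrait_realized (N d : nat) (K : fieldExtType rat)
    (iota : {rmorphism K -> algC}) (V : finType) (Phi : V -> V)
    (O : marked_endo N V algC -> Prop) :
  moduli_point d Phi iota O ->
  exists (g : poly_tuple N K) (Q : V -> proj_space N K),
    [/\ is_endo d iota g, injective Q
      & forall v, endo_map g (Q v) = Q (Phi v)].
Proof.
move=> [[m [em injm mPhi] Om] galO].
pose S (s : {rmorphism algC -> algC}) :=
  bijective s /\ forall x, s (iota x) = iota x.
pose p v := (coords (m.2 v))^T.
have [s [bij_s s_iota]|a [M [a0 uM fixM]]] :=
    @fixed_coordinates V N.+1 algC S p.
  have m1 : (sl_act 1%:M m).2 = m.2.
    by apply/ffunP=> v; rewrite ffunE invmx1 mul1mx coordsK.
  (* Acting by the identity matrix gives a member of the orbit by reflexivity alone, without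
     comparing [conj_tuple 1%:M m.1] with [m.1]; only its marked points matter. *)
  have : O (map_marked s (sl_act 1%:M m)).
    apply: galO => //; apply/Om; exists 1%:M; split=> //; first by rewrite det1.
    by exists 1 => [|i]; rewrite ?oner_neq0 ?scale1r.
  case/Om=> A [detA _ /ffunP sA].
  have uA : A \in unitmx by rewrite unitmxE detA unitr1.
  have ex_a v : exists c, c != 0 /\ map_mx s (p v) = c *: (p v *m (invmx A)^T).
    have := sA v; rewrite !ffunE invmx1 mul1mx coordsK.
    have nz : invmx A *m coords (m.2 v) != 0.
      apply: contraNneq (coords_neq0 (m.2 v)) => A0.
      by rewrite -[coords _](mulKVmx uA) A0 mulmx0.
    case/proj_ptP=> // [|c c0 Dc]; first by rewrite map_mx_eq0 coords_neq0.
    by exists c; rewrite c0 /p -map_trmx Dc linearZ /= trmx_mul.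
  have [a Da] := fin_all_exists ex_a; exists a, (invmx A)^T.
  by split=> [v||v]; rewrite ?unitmx_tr ?unitmx_inv //; case: (Da v).
(* Vectors for the marked points after the change of coordinates; Galois invariance makes their
   entries come from [K]. *)
pose x v := a v *: (M^T *m coords (m.2 v)).
have xT v : (x v)^T = a v *: (p v *m M) by rewrite linearZ /= trmx_mul trmxK.
have [q Dq] : exists q : V -> 'cV[K]_N.+1, forall v, map_mx iota (q v) = x v.
  have ex_q v i : exists y, x v i 0 == iota y.
    have [s bij_s s_iota|y Dy] :=
        fixed_by_aut_num_field (iota := iota) (x := x v i 0).
      have /rowP/(_ i) := fixM s (conj bij_s s_iota) v.
      by rewrite -xT mxE [(x v)^T 0 i]mxE.
    by exists y; rewrite Dy.
  exists (fun v => \col_i xchoose (ex_q v i)) => v; apply/colP=> i.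
  by rewrite !mxE -(eqP (xchooseP (ex_q v i))) !mxE.
pose A := invmx M^T.
have uMT : M^T \in unitmx by rewrite unitmx_tr.
have Ax v : A *m x v = a v *: coords (m.2 v).
  by rewrite -scalemxAr mulKmx.
have x0 v : x v != 0.
  apply/eqP=> xv0; have /eqP := Ax v; rewrite xv0 mulmx0 eq_sym scaler_eq0.
  by rewrite (negPf (a0 v)) (negPf (coords_neq0 _)).
have q0 v : q v != 0 by rewrite -(map_mx_eq0 iota) Dq.
(* The conjugate of [m.1] for which the [x v] are the marked points; its coefficients may still lie
   outside [K]. *)
pose h := conj_tuple A m.1.
have invA : invmx A = M^T by rewrite invmxK.
have eh : is_endo d (idfun : {rmorphism algC -> algC}) h.
  split=> [i|y y0]; first exact: conj_tuple_homog em.1 i.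
  rewrite map_tuple_id eval_conj_tuple invA.
  have Ay0 : A *m y != 0.
    by apply: contraNneq y0 => Ay0; rewrite -[y](mulKVmx uMT) Ay0 mulmx0.
  apply: contraNneq (eval_neq0 em Ay0) => My0.
  by rewrite -[eval_tuple _ _](mulKmx uMT) My0 mulmx0.
have hq v : exists c,
    eval_tuple h (map_mx iota (q v)) = c *: map_mx iota (q (Phi v)).
  rewrite !Dq eval_conj_tuple invA Ax (eval_homogZ _ _ em.1).
  have [c Dc] : exists c,
      eval_tuple m.1 (coords (m.2 v)) = c *: coords (m.2 (Phi v)).
    apply/proj_pt_eqP; rewrite ?(eval_neq0 em) ?coords_neq0 //.
    by rewrite coordsK; apply: mPhi.
  (* Homogeneity of degree [d] yields [a v ^+ d]; the division passes from the scaling of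
     [coords (m.2 (Phi v))] to that of [x (Phi v)]. *)
  exists (a v ^+ d * c / a (Phi v)).
  by rewrite Dc scalerA -scalemxAr scalerA divfK.
have [g eg gq] := descend_portrait (pchar_num algC) eh q0 hq.
exists g, (fun v => proj_pt (q v)); split=> // [u v quv|v].
  apply: injm; rewrite -[LHS]coordsK -[RHS]coordsK.
  have /(proj_pt_eqP (q0 u) (q0 v))[c Dc] := quv.
  apply/proj_pt_eqP; rewrite ?coords_neq0 //; exists ((a u)^-1 * iota c * a v).
  rewrite -scalerA -Ax -Dq -[LHS]scale1r -(mulVf (a0 u)) -scalerA -Ax -Dq Dc.
  by rewrite map_mxZ -scalemxAr scalerA.
rewrite (endo_map_proj_pt eg) //; apply/proj_pt_eqP; rewrite ?(eval_neq0 eg) //.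
Qed.

Lemma map_marked_sl_act (N : nat) (V : finType) (F F' : fieldType)
    (s : {rmorphism F -> F'}) (A : 'M[F]_N.+1) (m : marked_endo N V F) :
  A \in unitmx ->
  map_marked s (sl_act A m) = sl_act (map_mx s A) (map_marked s m).
Proof.
move=> uA; congr (_, _); apply/ffunP=> i; rewrite !ffunE /=.
  rewrite (raddf_sum (map_mpoly s)); apply: eq_bigr => j _ /=.
  rewrite map_mpolyZ -map_invmx mxE ffunE (map_mpoly_comp _ _ (fmorph_inj s)).
  congr (_ *: (_ \mPo _)); apply: eq_from_tnth => k.
  rewrite tnth_map !tnth_mktuple (raddf_sum (map_mpoly s)).
  by apply: eq_bigr => l _; rewrite /= map_mpolyZ map_mpolyX mxE.
have P0 := coords_neq0 (m.2 i).
have nz (G : fieldType) (B : 'M[G]_N.+1) x : B \in unitmx -> x != 0 ->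
    invmx B *m x != 0.
  by move=> uB; apply: contraNneq => Bx; rewrite -[x](mulKVmx uB) Bx mulmx0.
have sP0 : map_mx s (coords (m.2 i)) != 0 by rewrite map_mx_eq0.
have [c c0 ->] := coords_proj_pt sP0.
rewrite map_proj_pt ?nz // map_mxM map_invmx -scalemxAr.
apply/proj_pt_eqP; rewrite ?scaler_eq0 ?negb_or ?c0 ?nz ?map_mx_eq0 ?map_unitmx //.
by exists c^-1; rewrite scalerA mulVf ?scale1r.
Qed.

(** The base change of the portrait to [L] is fixed by every automorphism over [K], and the action
    commutes with automorphisms, so its orbit is Galois stable. *)
Lemma moduli_point_of_portrait (N d : nat) (K : fieldType)
    (L : closedFieldType) (iota : {rmorphism K -> L}) (f : poly_tuple N K)
    (V : finType) (Phi : V -> V) (Q : V -> proj_space N K) :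
    is_endo d iota f -> injective Q ->
    (forall v, endo_map f (Q v) = Q (Phi v)) ->
  exists O : marked_endo N V L -> Prop, moduli_point d Phi iota O.
Proof.
move=> ef injQ fQ; pose x v := map_mx iota (coords (Q v)).
have x0 v : x v != 0 by rewrite map_mx_eq0 coords_neq0.
pose m : marked_endo N V L :=
  (Defs.map_tuple iota f, [ffun v => proj_pt (x v)]).
have em : is_endo d (idfun : {rmorphism L -> L}) m.1.
  split=> [i|y y0]; last by rewrite map_tuple_id; apply: ef.2.
  rewrite ffunE; apply/dhomogP => n.
  rewrite (perm_mem (msupp_map_mpoly _ (fmorph_inj iota))).
  by move: n; apply/dhomogP; apply: ef.1.
have fixm (s : {rmorphism L -> L}) :
    (forall y, s (iota y) = iota y) -> map_marked s m = m.
  move=> s_iota; congr (_, _); first exact: map_tuple_comp.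
  apply/ffunP=> v; rewrite !ffunE map_proj_pt //; congr (proj_pt _).
  by apply/colP=> i; rewrite !mxE s_iota.
exists (sl_orbit m); split.
  exists m => //; split=> // [u v|v]; rewrite ?ffunE.
    move=> /(map_proj_pt_inj (coords_neq0 _) (coords_neq0 _)).
    by rewrite !coordsK => /injQ.
  rewrite (endo_map_proj_pt em) // /x -fQ eval_map_tuple.
  by rewrite /endo_map map_proj_pt // (eval_neq0 ef) ?coords_neq0.
move=> s _ /fixm fix_m m' [A [detA [c c0 fA] PA]].
have uA : A \in unitmx by rewrite unitmxE detA unitr1.
have sA := map_marked_sl_act s m uA; rewrite fix_m in sA.
exists (map_mx s A); rewrite -sA det_map_mx detA rmorph1; split=> //.
  exists (s c) => [|i]; first by rewrite fmorph_eq0.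
  have map1 X : (map_marked s X).1 i = map_mpoly s (X.1 i) by rewrite ffunE.
  by rewrite !map1 fA map_mpolyZ.
by apply/ffunP=> v; rewrite ffunE PA [RHS]ffunE.
Qed.

(** * Finite sets of preperiodic points and the equivalence *)

Lemma card_at_mostPn (T : eqType) (S : T -> Prop) (C : nat) :
  ~ card_at_most S C ->
  exists s : seq T, [/\ uniq s, size s = C.+1 & forall x, x \in s -> S x].
Proof.
move=> nC; suff : forall n, (n <= C.+1)%N ->
    exists s : seq T, [/\ uniq s, size s = n & forall x, x \in s -> S x] by apply.
elim=> [|n IH] ltnC; first by exists [::].
have [s [Us ss Ss]] := IH (ltnW ltnC).
have [x [Sx xs]] : exists x, S x /\ x \notin s.
  apply: NNPP => no; apply: nC; exists s; split=> [|x Sx]; first by rewrite ss.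
  by apply: NNPP => xs; apply: no; exists x; split=> //; apply/negP.
exists (x :: s); split=> [||y]; rewrite /= ?xs ?ss //.
by rewrite inE => /predU1P[->//|/Ss].
Qed.

(** For each [x] the first [n] iterates suffice: the image of the last one is the iterate [n], which
    equals the earlier iterate [m]. *)
Lemma preperiodic_closure (T : eqType) (g : T -> T) (s : seq T) :
  (forall x, x \in s -> preperiodic g x) ->
  exists t : seq T, {subset s <= t} /\ forall x, x \in t -> g x \in t.
Proof.
elim: s => [|x s IH] pre; first by exists [::].
have [y ys|t [st gt]] := IH; first by apply: pre; rewrite inE ys orbT.
have [m [n [ltmn mn]]] := pre x (mem_head x s).
exists (traject g x n ++ t); split=> [y|y].
  rewrite inE mem_cat => /predU1P[->|/st ->]; last by rewrite orbT.
  by apply/orP; left; apply/trajectP; exists 0%N => //; apply: leq_ltn_trans ltmn.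
rewrite !mem_cat => /orP[/trajectP[i ltin ->]|/gt ->]; last by rewrite orbT.
apply/orP; left; apply/trajectP; rewrite -iterS.
have [->|ne] := eqVneq i.+1 n; last by exists i.+1; rewrite // ltn_neqAle ne.
by exists m.
Qed.

Theorem theorem17p5 :
  (forall D N d : nat, (1 <= D)%N -> (1 <= N)%N -> (2 <= d)%N ->
    exists C3 : nat,
      forall (K : fieldExtType rat) (iota : {rmorphism K -> algC})
             (f : poly_tuple N K),
        (\dim {:K} <= D)%N -> is_endo d iota f ->
        card_at_most (fun P : proj_space N K => preperiodic (endo_map f) P) C3)
  <->
  (forall D N d : nat, (1 <= D)%N -> (1 <= N)%N -> (2 <= d)%N ->
    exists C4 : nat,
      forall (K : fieldExtType rat) (iota : {rmorphism K -> algC})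
             (V : finType) (Phi : V -> V),
        (\dim {:K} <= D)%N -> (C4 <= #|V|)%N ->
        ~ exists O : marked_endo N V algC -> Prop, moduli_point d Phi iota O).
Proof.
split=> bound D N d D1 N1 d2; have [C bC] := bound D N d D1 N1 d2.
  (* Every element of the finite set [V] is preperiodic under [Phi], so [V] injects into the
     preperiodic points of [g], of which there are at most [C]. *)
  exists C.+1 => K iota V Phi leKD ltCV [O /portrait_realized[g [Q [eg injQ gQ]]]].
  have [s [leC preS]] := bC K iota g leKD eg; move: ltCV; apply/negP.
  rewrite -leqNgt (leq_trans _ leC) // cardE -(size_map Q).
  apply: uniq_leq_size => [|_ /mapP[v _ ->]].
    by rewrite map_inj_uniq ?enum_uniq.
  apply: preS; have [m [n [ltmn mn]]] := iter_repeats Phi v.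
  have iterQ k : iter k (endo_map g) (Q v) = Q (iter k Phi v).
    by elim: k => //= k ->.
  by exists m, n; rewrite !iterQ mn.
(* If the bound [C] failed, there would be [C.+1] distinct preperiodic points; their forward closure
   [t] is stable under [f] and carries a portrait that is too large. *)
exists C => K iota f leKD ef; apply: NNPP => /card_at_mostPn[s [Us szs pre_s]].
have [t [Ut st ft]] : exists t, [/\ uniq t, {subset s <= t}
    & forall P, P \in t -> endo_map f P \in t].
  have [t [st ft]] := preperiodic_closure pre_s; exists (undup t).
  by split=> [|P /st|P]; rewrite ?undup_uniq ?mem_undup //; apply: ft.
pose Phi (v : seq_sub t) : seq_sub t := SeqSub (ft _ (ssvalP v)).
apply: (bC K iota (seq_sub t) Phi leKD).
  by rewrite card_seq_sub // (leq_trans (leqnSn C)) // -szs uniq_leq_size.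
by apply: moduli_point_of_portrait ef val_inj _ => v.
Qed.
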